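(* Let $(X,T)$ be a minimal system. Then $(X,T)$ is broken $\mathcal{F}_{ps}$-sensitive if and only if it is not a proximal extension of its maximal equicontinuous factor.
   Context: A (topological dynamical) system $(X,T)$ is a compact metric space $X$ with metric $d$ and a continuous surjective map $T\colon X\to X$; it is minimal if it has no proper non-empty closed $T$-invariant subset. $\mathbb{Z}_+=\{0,1,2,\dots\}$, $\mathbb{N}=\{1,2,\dots\}$. ''Opene'' means non-empty open. A set $A\subset\mathbb{Z}_+$ is thick if for every $l\ge1$ there is $n_l\in\mathbb{N}$ with $\{n_l,\dots,n_l+l\}\subset A$; syndetic if there is $N\in\mathbb{N}$ such that $\{k,\dots,k+N\}\cap A\ne\emptyset$ for every $k\in\mathbb{N}$; piecewise syndetic if it is the intersection of a thick set and a syndetic set. $\mathcal{F}_{ps}$ is the family of piecewise syndetic subsets of $\mathbb{Z}_+$. For a family $\mathcal{F}$ of subsets of $\mathbb{Z}_+$, $(X,T)$ is broken $\mathcal{F}$-sensitive (i.e. broken $\mathcal{F}$-$2$-sensitive) if there exist $\delta>0$ and $F\in\mathcal{F}$ such that for every opene $U\subset X$ and every $l\in\mathbb{N}$ there exist $x_1^l,x_2^l\in U$ and $m_l\in\mathbb{Z}_+$ with $d(T^kx_1^l,T^kx_2^l)>\delta$ for all $k\in m_l+(F\cap[1,l])$. A factor map $\pi\colon(X,T)\to(Y,S)$ is a continuous surjection with $\pi\circ T=S\circ\pi$. A system is equicontinuous if for every $\varepsilon>0$ there is $\delta>0$ such that $d(x,y)<\delta$ implies $d(T^mx,T^my)<\varepsilon$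 for all $m\in\mathbb{N}$. The maximal equicontinuous factor $(X_{eq},T_{eq})$ is the equicontinuous factor of $(X,T)$ such that every equicontinuous factor of $(X,T)$ is a factor of it; it is the quotient of $X$ by the smallest closed $T\times T$-invariant equivalence relation with equicontinuous quotient, and $\pi\colon X\to X_{eq}$ denotes the quotient map. A pair $(x_1,x_2)$ is proximal if for every $\varepsilon>0$ there is a positive integer $m$ with $d(T^mx_1,T^mx_2)<\varepsilon$. $(X,T)$ is a proximal extension of $(Y,S)$ via $\pi$ if every pair $(x_1,x_2)$ with $\pi(x_1)=\pi(x_2)$ is proximal. *)

(* Defs.v *)
From HB Require Import structures.
From mathcomp Require Import all_boot all_order all_algebra.
From mathcomp Require Import all_classical all_reals all_analysis.

Set Implicit Arguments.
Unset Strict Implicit.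
Unset Printing Implicit Defensive.

Import Order.TTheory GRing.Theory Num.Theory.

Local Open Scope classical_set_scope.
Local Open Scope ring_scope.

Definition thick (A : set nat) : Prop :=
  forall l : nat, (1 <= l)%N ->
    exists n : nat, (1 <= n)%N /\
      forall i : nat, (n <= i <= n + l)%N -> A i.

Definition syndetic (A : set nat) : Prop :=
  exists N : nat, (1 <= N)%N /\
    forall k : nat, (1 <= k)%N ->
      exists i : nat, (k <= i <= k + N)%N /\ A i.

Definition piecewise_syndetic : set (set nat) :=
  [set A | exists B C : set nat, [/\ thick B, syndetic C & A = B `&` C]].

(* The empty space is not a system: otherwise it would be minimal, and
   vacuously both sensitive and a proximal extension of every factor. *)
Definition is_system (R : realType) (X : metricType R) (T : X -> X) : Prop :=
  [/\ [set: X] !=set0, compact [set: X], continuous T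
    & set_surj [set: X] [set: X] T].

Definition minimal_system (R : realType) (X : metricType R) (T : X -> X) :
    Prop :=
  is_system T /\
  forall A : set X, closed A -> A !=set0 -> T @` A `<=` A -> A = [set: X].

Definition broken_sensitive (R : realType) (F : set (set nat))
    (X : metricType R) (T : X -> X) : Prop :=
  exists delta : R, 0 < delta /\
  exists A : set nat, F A /\
  forall U : set X, open U -> U !=set0 ->
  forall l : nat, (1 <= l)%N ->
  exists (x1 x2 : X) (m : nat), [/\ U x1, U x2 &
    forall k : nat, A k -> (1 <= k <= l)%N ->
      delta < mdist (iter (m + k) T x1) (iter (m + k) T x2)].

Definition factor_map (R : realType) (X Y : metricType R)
    (T : X -> X) (S : Y -> Y) (pi : X -> Y) : Prop :=
  [/\ continuous pi, set_surj [set: X] [set: Y] pi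
    & forall x : X, pi (T x) = S (pi x)].

Definition equicontinuous_system (R : realType) (X : metricType R)
    (T : X -> X) : Prop :=
  is_system T /\
  forall eps : R, 0 < eps ->
  exists delta : R, 0 < delta /\
    forall x y : X, mdist x y < delta ->
    forall m : nat, (1 <= m)%N -> mdist (iter m T x) (iter m T y) < eps.

(* The factor map psi from Y is required to commute with the projections from X,
   i.e. the kernel of pi is contained in the kernel of every factor map onto an
   equicontinuous system. Kernels of factor maps are exactly the closed
   T x T-invariant equivalence relations, so pi is, up to isomorphism, the
   quotient map by the smallest one with equicontinuous quotient. *)
Definition max_equicontinuous_factor (R : realType) (X Y : metricType R)
    (T : X -> X) (S : Y -> Y) (pi : X -> Y) : Prop :=
  [/\ equicontinuous_system S, factor_map T S pi &
    forall (Z : metricType R) (Q : Z -> Z) (phi : X -> Z),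
      equicontinuous_system Q -> factor_map T Q phi ->
      exists psi : Y -> Z,
        factor_map S Q psi /\ forall x : X, psi (pi x) = phi x].

Definition proximal_pair (R : realType) (X : metricType R) (T : X -> X)
    (x1 x2 : X) : Prop :=
  forall eps : R, 0 < eps ->
  exists m : nat, (0 < m)%N /\ mdist (iter m T x1) (iter m T x2) < eps.

Definition proximal_extension (R : realType) (X Y : metricType R)
    (T : X -> X) (S : Y -> Y) (pi : X -> Y) : Prop :=
  factor_map T S pi /\
  forall x1 x2 : X, pi x1 = pi x2 -> proximal_pair T x1 x2.

(* Main.v *)
From HB Require Import structures.
Require Import Defs.
From mathcomp Require Import all_boot all_order all_algebra.
From mathcomp Require Import all_classical all_reals all_analysis.
From mathcomp Require Import lra zify.

(** Both directions compare sensitivity with the sets of times at which two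
    orbits are close.

    If the extension is proximal, compactness upgrades proximality of the pairs
    in the fibres of [pi] to a uniform statement: points whose images are
    [r]-close come, within a bounded time [M], so close that they stay
    [delta]-close on a whole window of length [N].  Equicontinuity of the factor
    keeps the images of two points of a small open set [r]-close forever, so
    such windows recur with bounded gaps along their orbits.  A piecewise
    syndetic set is syndetic inside arbitrarily long intervals, hence has an
    element in one of the windows, and separation at the times of that set fails
    ([proximal_extension_not_broken_sensitive]).

    Conversely, suppose that the system is not broken sensitive, and apply this
    to the set of all times.  By minimality any two close points enter together
    the open set that witnesses the failure, which gives [syndetic_return]: pairs that are close once are [delta]-close again with
    gaps bounded in terms of [delta] alone.  Call two points [e]-meeting if
    their orbits are [e]-close at some common time.  Syndetic return makes these
    relations a base of a uniformity ([meet_within_split]) on which the iterates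
    of the map act equicontinuously ([meet_within_iter]).  Metrizing its
    Hausdorff quotient yields an equicontinuous factor in which only proximal
    pairs are identified ([proximal_kernel_equicontinuous_factor]).  The maximal
    equicontinuous factor lies above it, so the fibres of [pi] consist of
    proximal pairs. *)

Set Implicit Arguments.
Unset Strict Implicit.
Unset Printing Implicit Defensive.

Import Order.TTheory GRing.Theory Num.Theory.
Import metricType_numDomainType.

Local Open Scope classical_set_scope.
Local Open Scope ring_scope.

(** * Uniformity from compactness *)

(** A Lebesgue number lemma for the compact set of pairs identified by [pi]:
    away from it the distance of the images is bounded below, so neighbourhoods
    of its points are enough.  For [pi] the identity it concerns the diagonal
    and yields uniform continuity and uniform hitting times. *)
Lemma compact_kernel_uniform (R : realType) (X Y : metricType R) (pi : X -> Y)
    (W : nat -> set (X * X)) :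
  compact [set: X] -> continuous pi ->
  (forall n m, (n <= m)%N -> W n `<=` W m) ->
  (forall x y, pi x = pi y -> exists n, nbhs (x, y) (W n)) ->
  exists r n, 0 < r /\
    forall x y, mdist (pi x) (pi y) < r -> W n (x, y).
Proof.
move=> cX cpi Wmono Wker.
have cXX : compact [set: X * X] by rewrite -setXTT; exact: compact_setX.
have pi_near a e : 0 < e -> \forall b \near a, mdist (pi a) (pi b) < e.
  by move=> e0; exact: (cvgr_dist_lt (cpi a)).
(* Near a pair outside the kernel the implication P is vacuous for large n. *)
pose P n (p : X * X) := mdist (pi p.1) (pi p.2) < n.+1%:R^-1 -> W n p.
suff [N _ /(_ N (leqnn N)) NP] : \forall n \near \oo, [set: X * X] `<=` P n.
  by exists N.+1%:R^-1, N; split=> // x y; exact: (NP (x, y)).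
move/compact_near_coveringP : cXX; apply => -[x y] _.
have [pixy|/eqP pixy] := pselect (pi x = pi y).
  have [n Wn] := Wker _ _ pixy.
  exists (W n, [set m | (n <= m)%N]); first by split=> //; exists n.
  by move=> [p m] [/= Wp nm] _; exact: Wmono Wp.
have D0 : 0 < mdist (pi x) (pi y) by rewrite mdist_gt0.
have D4 : 0 < mdist (pi x) (pi y) / 4 by lra.
exists ([set p | mdist (pi x) (pi p.1) < mdist (pi x) (pi y) / 4 /\
                 mdist (pi y) (pi p.2) < mdist (pi x) (pi y) / 4],
        [set m | m.+1%:R^-1 < mdist (pi x) (pi y) / 4]).
  split; last exact: (near_infty_natSinv_lt (PosNum D4)).
  exists ([set a | mdist (pi x) (pi a) < mdist (pi x) (pi y) / 4],
          [set a | mdist (pi y) (pi a) < mdist (pi x) (pi y) / 4]).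
    by split; exact: pi_near.
  by move=> [a b] [/= ? ?].
move=> [[a b] m] [/= [xa yb] mD] /= ab; exfalso.
have := metric_triangle (pi x) (pi a) (pi y).
have := metric_triangle (pi a) (pi b) (pi y).
rewrite (metric_sym (pi b)).
by move: (lt_trans ab mD) xa yb; clear ab mD => /=; lra.
Qed.

Lemma iter_unif_continuous (R : realType) (X : metricType R) (T : X -> X) :
  compact [set: X] -> continuous T ->
  forall e N, 0 < e -> exists d, 0 < d /\ forall x y, mdist x y < d ->
    forall j, (j <= N)%N -> mdist (iter j T x) (iter j T y) < e.
Proof.
move=> cX cT e + e0.
have Tuc e' : 0 < e' -> exists d, 0 < d /\
    forall x y, mdist x y < d -> mdist (T x) (T y) < e'.
  move=> e'0; have e'2 : 0 < e' / 2 by lra.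
  have [||x y /= <-|r [_ [r0 rP]]] := @compact_kernel_uniform _ X X id
    (fun _ => [set p | mdist (T p.1) (T p.2) < e']) cX.
  - by move=> x A.
  - by move=> n m _ p.
  - exists 0%N.
    exists ([set a | mdist (T x) (T a) < e' / 2],
            [set a | mdist (T x) (T a) < e' / 2]).
      by split; exact: (cvgr_dist_lt (cT x)).
    move=> [a b] [/= xa xb].
    have := metric_triangle (T a) (T x) (T b).
    rewrite (metric_sym (T a) (T x)) /=; lra.
  - by exists r.
elim=> [|N [d [d0 dP]]].
  by exists e; split=> // x y xy j; rewrite leqn0 => /eqP ->.
have [d' [d'0 d'P]] := Tuc _ d0.
exists (Num.min d' e); split; first by rewrite lt_min d'0.
move=> x y; rewrite lt_min => /andP[xy xye] [//|j jN].
by rewrite !iterSr; apply: dP => //; exact: d'P.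
Qed.

Lemma continuous_iter (X : topologicalType) (T : X -> X) n :
  continuous T -> continuous (iter n T).
Proof.
move=> cT; elim: n => [|n IHn] x; first by move=> A.
exact: (continuous_comp (IHn x) (cT _)).
Qed.

(** * Proximal extensions of equicontinuous systems *)

Lemma factor_iter (R : realType) (X Y : metricType R) (T : X -> X)
    (S : Y -> Y) (pi : X -> Y) n x :
  factor_map T S pi -> pi (iter n T x) = iter n S (pi x).
Proof. by move=> [_ _ piT]; elim: n => //= n <-. Qed.

(** Two points of a small open set keep close images under [pi], hence their
    orbits are [delta]-close on windows of length [N] whose gaps are at most
    [M]; a thick set contains an interval of length [M + N], and a syndetic set
    with gaps [N] meets the window inside that interval. *)
Lemma proximal_extension_not_broken_sensitive (R : realType)
    (X Y : metricType R) (T : X -> X) (S : Y -> Y) (pi : X -> Y) :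
  is_system T -> equicontinuous_system S -> proximal_extension T S pi ->
  ~ broken_sensitive piecewise_syndetic T.
Proof.
move=> [[x0 _] cX cT _] [_ Seq] [fpi prox].
case=> delta [delta0 [_ [[B [C [thB [N [N1 syC]] ->]]] sens]]].
have [eta [eta0 etaP]] := iter_unif_continuous cX cT N delta0.
pose W n : set (X * X) := [set p | exists m, (m <= n)%N /\
  mdist (iter m T p.1) (iter m T p.2) < eta].
have [||x y pixy|r [M [r0 rP]]] := @compact_kernel_uniform _ X Y pi W cX.
- by have [] := fpi.
- by move=> n m nm p [k [kn pk]]; exists k; split=> //; exact: leq_trans nm.
- have [m [_ mP]] := prox _ _ pixy _ eta0; exists m.
  pose e := (eta - mdist (iter m T x) (iter m T y)) / 2.
  have e0 : 0 < e by rewrite /e; lra.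
  have cTm : continuous (iter m T) := continuous_iter cT.
  exists ([set a | mdist (iter m T x) (iter m T a) < e],
          [set b | mdist (iter m T y) (iter m T b) < e]).
    by split; exact: (cvgr_dist_lt (cTm _)).
  move=> [a b] [/= xa yb]; exists m; split=> //=.
  have := metric_triangle (iter m T a) (iter m T x) (iter m T b).
  have := metric_triangle (iter m T x) (iter m T y) (iter m T b).
  rewrite (metric_sym (iter m T a) (iter m T x)).
  move: xa yb; rewrite /e; lra.
have [s [s0 sP]] := Seq _ r0.
have [cpi _ _] := fpi.
(* The interval [n, n + M + N] of B holds a close meeting time n + k, k <= M,
   and the window [n + k, n + k + N] that follows it. *)
have [n [n1 nB]] := thB (M + N)%N ltac:(lia).
pose U : set X := interior [set x | mdist (pi x0) (pi x) < s / 2].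
have U0 : U x0.
  by apply: (cvgr_dist_lt (cpi x0)); lra.
have [x [y [m [Ux Uy xyP]]]] :=
  sens U (@open_interior _ _) (ex_intro _ x0 U0) (n + M + N)%N ltac:(lia).
have pixy : mdist (pi x) (pi y) < s.
  have /= := interior_subset Ux; have /= := interior_subset Uy.
  have := metric_triangle (pi x) (pi x0) (pi y).
  by rewrite (metric_sym (pi x) (pi x0)); lra.
have [k [/= kM kP]] := rP (iter (m + n) T x) (iter (m + n) T y)
  ltac:(rewrite !(factor_iter _ _ fpi); apply: sP => //; lia).
have [i [/andP[ki iN] Ci]] := syC (n + k)%N ltac:(lia).
have := xyP i (conj (nB _ _) Ci) ltac:(lia).
have := etaP _ _ kP (i - (n + k))%N ltac:(lia).
rewrite -!iterD; have -> : (i - (n + k) + k + (m + n) = m + i)%N by lia.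
move=> lt1 lt2; have := lt2 ltac:(lia).
by move=> /lt_trans /(_ lt1); rewrite ltxx.
Qed.

(** * Systems that are not broken sensitive *)

Definition syndetic_return (R : realType) (X : metricType R) (T : X -> X) :=
  forall delta : R, 0 < delta -> exists (eps : R) (L : nat), 0 < eps /\
    forall x y, mdist x y < eps -> forall m, exists k, (k <= L)%N /\
      mdist (iter (m + k) T x) (iter (m + k) T y) <= delta.

(** The failure of sensitivity for the set of all times provides an open set
    [U] all of whose pairs return with gaps [l].  Every orbit visits [U] by
    minimality, and by compactness two close points visit it at the same time,
    at most [J]. *)
Lemma not_broken_sensitive_syndetic_return (R : realType) (X : metricType R)
    (T : X -> X) :
  minimal_system T -> ~ broken_sensitive piecewise_syndetic T ->
  syndetic_return T.
Proof.
move=> [[_ cX cT _] minT] nsens delta delta0.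
have [U [l [Uo U0 Ul]]] : exists (U : set X) (l : nat), [/\ open U, U !=set0 &
    forall x y m, U x -> U y -> exists k, (k <= l)%N /\
      mdist (iter (m + k) T x) (iter (m + k) T y) <= delta].
  apply: contrapT => noU; apply: nsens; exists delta; split=> //.
  exists setT; split.
    exists setT, setT; split; last by rewrite setIT.
      by move=> l _; exists 1%N.
    by exists 1%N; split=> // k _; exists k; split=> //; lia.
  move=> U Uo U0 l _; apply: contrapT => nxy; apply: noU; exists U, l.
  split=> // x y m Ux Uy; apply: contrapT => nk; apply: nxy.
  exists x, y, m; split=> // k _ /andP[_ kl]; rewrite ltNge; apply/negP => le.
  by apply: nk; exists k.
(* The points whose orbits avoid U form a closed invariant set. *)
have hit x : exists j, U (iter j T x).
  apply: contrapT => nox.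
  pose A := \bigcap_(j in [set: nat]) (iter j T @^-1` ~` U).
  have /minT AT : closed A.
    apply: closed_bigI => j _; apply: preimage_closed.
      by move=> z _; exact: continuous_iter.
    exact: open_closedC.
  have [u Uu] := U0.
  suff : A u by move=> /(_ 0%N I); exact.
  rewrite AT //; first by exists x => j _ Uj; apply: nox; exists j.
  by move=> _ [z Az <-] j _ /=; rewrite -iterSr; exact: Az.
pose W n : set (X * X) := [set p | exists j, (j <= n)%N /\
  U (iter j T p.1) /\ U (iter j T p.2)].
have [||x y /= <-|r [J [r0 rP]]] := @compact_kernel_uniform _ X X id W cX.
- by move=> x A.
- by move=> n m nm p [k [kn pk]]; exists k; split=> //; exact: leq_trans nm.
- have [j Uj] := hit x; exists j.
  have nj : nbhs x (iter j T @^-1` U).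
    by apply: (continuous_iter cT); exact: open_nbhs_nbhs.
  exists (iter j T @^-1` U, iter j T @^-1` U) => //.
  by move=> [a b] [/= Ua Ub]; exists j.
exists r, (l + J)%N; split=> // x y /rP[j [jJ [/= Ux Uy]]] m.
have [k [kl kP]] := Ul _ _ m Ux Uy.
exists (j + k)%N; split; first by lia.
by move: kP; rewrite -!iterD (_ : m + k + j = m + (j + k))%N //; lia.
Qed.

(** * The uniformity of meeting orbits *)

Definition meet_within (R : realType) (X : metricType R) (T : X -> X)
    (e : R) (x y : X) : Prop :=
  exists k, mdist (iter k T x) (iter k T y) < e.

(** The form in which syndetic return is used below: from the time of a close
    meeting on, only the bound [L] on the gaps matters, whatever the pair. *)
Lemma meet_within_return (R : realType) (X : metricType R) (T : X -> X) :
  syndetic_return T -> forall e : R, 0 < e ->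
  exists (d : R) (L : nat), 0 < d /\ forall x y, meet_within T d x y ->
    exists n0, forall n, (n0 <= n)%N -> exists k, (k <= L)%N /\
      mdist (iter (n + k) T x) (iter (n + k) T y) < e.
Proof.
move=> ret e e0; have e2 : 0 < e / 2 by lra.
have [d [L [d0 dP]]] := ret _ e2; exists d, L; split=> // x y [n0 /dP xy].
exists n0 => n n0n; have [k [kL kP]] := xy (n - n0)%N; exists k; split=> //.
move: kP; rewrite -!iterD (_ : (n - n0 + k + n0 = n + k)%N); last by lia.
lra.
Qed.

(** The times at which [x], [y] are close and those at which [y], [z] are close
    are both syndetic, but two syndetic sets may be disjoint.  The remedy is to
    use two scales: [x] and [y] get so close that they stay close for the whole
    gap length [L1] of the pair [y], [z], which must be close at some time in
    between. *)
Lemma meet_within_split (R : realType) (X : metricType R) (T : X -> X) :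
  compact [set: X] -> continuous T -> syndetic_return T ->
  forall e : R, 0 < e -> exists d : R, 0 < d /\ forall x y z,
    meet_within T d x y -> meet_within T d y z -> meet_within T e x z.
Proof.
move=> cX cT ret e e0; have e2 : 0 < e / 2 by lra.
have [d1 [L1 [d10 ret1]]] := meet_within_return ret e2.
have [eta [eta0 etaP]] := iter_unif_continuous cX cT L1 e2.
have [d2 [L2 [d20 ret2]]] := meet_within_return ret eta0.
exists (Num.min d1 d2); split; first by rewrite lt_min d10.
have mono (d d' : R) x y : d <= d' -> meet_within T d x y -> meet_within T d' x y.
  by move=> dd' [k xy]; exists k; exact: lt_le_trans xy dd'.
move=> x y z xy yz.
have /ret2[n2 xyP] : meet_within T d2 x y.
  by apply: mono xy; rewrite ge_min lexx orbT.
have /ret1[n1 yzP] : meet_within T d1 y z.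
  by apply: mono yz; rewrite ge_min lexx.
have [k [_ /etaP xyk]] := xyP (maxn n1 n2) (leq_maxr _ _).
have [j [/xyk xyj yzj]] := yzP (maxn n1 n2 + k)%N ltac:(lia).
exists (maxn n1 n2 + k + j)%N.
move: xyj; rewrite -!iterD (addnC j) => xyj.
have := metric_triangle (iter (maxn n1 n2 + k + j) T x)
  (iter (maxn n1 n2 + k + j) T y) (iter (maxn n1 n2 + k + j) T z).
lra.
Qed.

(** Meeting is inherited backwards in time for free; syndetic return gives the
    forward direction, uniformly in [m]. *)
Lemma meet_within_iter (R : realType) (X : metricType R) (T : X -> X) :
  syndetic_return T -> forall e : R, 0 < e -> exists d : R, 0 < d /\
    forall x y, meet_within T d x y ->
    forall m, meet_within T e (iter m T x) (iter m T y).
Proof.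
move=> ret e e0; have [d [L [d0 dP]]] := meet_within_return ret e0.
exists d; split=> // x y /dP[n0 xy] m.
have [k [_ kP]] := xy (n0 + m)%N (leq_addr _ _).
by exists (n0 + k)%N; rewrite -!iterD (_ : (n0 + k + m = n0 + m + k)%N) //; lia.
Qed.

(** * Metrization and quotient *)

(** Relations indexed by positive reals with a weak triangle property generate
    a uniformity with a countable base, which is pseudometrizable.  The
    pseudometric is recovered from the balls as the infimum of the admissible
    radii. *)
Lemma pseudometric_of_relations (R : realType) (X : Type)
    (V : R -> X -> X -> Prop) :
  (forall (e : R) x, 0 < e -> V e x x) ->
  (forall e x y, V e x y -> V e y x) ->
  (forall d e x y, d <= e -> V d x y -> V e x y) ->
  (forall e : R, 0 < e -> exists d : R, 0 < d /\
    forall x y z, V d x y -> V d y z -> V e x z) ->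
  exists rho : X -> X -> R, [/\
    forall x, rho x x = 0,
    forall x y, rho x y = rho y x,
    forall y x z, rho x z <= rho x y + rho y z,
    forall e : R, 0 < e -> exists d : R, 0 < d /\ forall x y, rho x y < d -> V e x y
  & forall e : R, 0 < e -> exists d : R, 0 < d /\ forall x y, V d x y -> rho x y < e].
Proof.
move=> Vrefl Vsym Vmono Vsplit.
pose ent : set_system (X * X) :=
  [set A | exists e, 0 < e /\ forall x y, V e x y -> A (x, y)].
have entF : Filter ent.
  split.
  - by exists 1; split=> // x y.
  - move=> A B [d [d0 dA]] [e [e0 eB]].
    exists (Num.min d e); split; first by rewrite lt_min d0.
    move=> x y Vxy; split.
      by apply/dA/(Vmono _ _ _ _ _ Vxy); rewrite ge_min lexx.
    by apply/eB/(Vmono _ _ _ _ _ Vxy); rewrite ge_min lexx orbT.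
  - by move=> A B AB [e [e0 eA]]; exists e; split=> // x y /eA /AB.
have ent_refl A : ent A -> diagonal `<=` A.
  by move=> [e [e0 eA]] [x y]; rewrite /diagonal /= => <-; apply/eA/Vrefl.
have ent_inv A : ent A -> ent A^-1%relation.
  by move=> [e [e0 eA]]; exists e; split=> // x y /Vsym /eA.
have ent_split A : ent A -> exists2 B, ent B & (B \; B `<=` A)%relation.
  move=> [e [e0 eA]]; have [d [d0 dP]] := Vsplit _ e0.
  exists [set p | V d p.1 p.2]; first by exists d.
  by move=> [x z] [y /= xy yz]; apply/eA/(dP _ y).
(* {classic X} supplies the choice structure that uniform spaces carry. *)
pose M := isUniform.Build {classic X} entF ent_refl ent_inv ent_split.
pose U : uniformType := HB.pack {classic X} M.
have entE : @entourage U = ent by [].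
have cU : countable_uniformity U.
  apply/countable_uniformityP.
  exists (fun n => [set p : X * X | V n.+1%:R^-1 p.1 p.2]) => [A|n].
    rewrite entE => -[e [e0 eA]].
    have [N _ /(_ N (leqnn N)) Ne] := near_infty_natSinv_lt (PosNum e0).
    by exists N => -[x y] /= xy; apply: eA; exact: Vmono (ltW Ne) xy.
  by rewrite entE; exists n.+1%:R^-1; split.
pose C : pseudoMetricType R := countable_uniform cU.
have entC : @entourage C = ent by [].
pose S (x y : C) := [set e : R | 0 < e /\ ball x e y].
(* The balls of radius 2 are the whole space, so every infimum is finite. *)
have S2 x y : S x y 2 by split=> //; exact: countable_uniform.countable_uniform_bounded.
have Slb x y : lbound (S x y) 0 by move=> e [/ltW].
have Sinf x y : has_inf (S x y) by split; [exists 2; exact: S2|exists 0].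
pose rho (x y : C) := inf (S x y).
have rho_le x y e : 0 < e -> ball x e y -> rho x y <= e.
  by move=> e0 xy; apply: ge_inf => //; exists 0.
have rho_lt x y e : rho x y < e -> ball x e y.
  move=> xye; have [d [_ xy] /ltW de] := inf_lt (Sinf x y).1 xye.
  exact: le_ball de _ xy.
have rho_ge0 x y : 0 <= rho x y by apply: lb_le_inf => //; exists 2.
exists rho; split.
- move=> x; apply/eqP; rewrite eq_le rho_ge0 andbT; apply/ler_addgt0Pl => e e0.
  by rewrite addr0; apply: rho_le => //; exact: ballxx.
- move=> x y; congr inf; apply/seteqP.
  by split=> e [e0 /ball_sym xy]; split.
- move=> y x z; apply/ler_addgt0Pl => e e0.
  have e2 : 0 < e / 2 by lra.
  have := @ball_triangle _ C y x z (rho x y + e / 2) (rho y z + e / 2).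
  move=> /(_ (rho_lt _ _ _ _) (rho_lt _ _ _ _)) H.
  have := rho_le _ _ _ _ (H _ _).
  have := rho_ge0 x y; have := rho_ge0 y z.
  rewrite (_ : e + _ = rho x y + e / 2 + (rho y z + e / 2)); last by lra.
  by move=> ? ?; apply; lra.
- move=> e e0.
  have : @entourage C [set p | V e p.1 p.2] by rewrite entC; exists e.
  rewrite -entourage_ballE => -[d /= d0 dP].
  by exists d; split=> // x y /rho_lt xy; exact: (dP (x, y)).
- move=> e e0; have e2 : 0 < e / 2 by lra.
  have : @entourage C [set p | ball p.1 (e / 2) p.2].
    exact: (entourage_ball C (PosNum e2)).
  rewrite entC => -[d [d0 dP]]; exists d; split=> // x y /dP /= /(rho_le _ _ _ e2).
  lra.
Qed.

(** The section [s] is there to define maps on the quotient by choosing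
    representatives. *)
Lemma metric_quotient (R : realType) (X : Type) (rho : X -> X -> R) :
  (forall x, rho x x = 0) ->
  (forall x y, rho x y = rho y x) ->
  (forall y x z, rho x z <= rho x y + rho y z) ->
  exists (Z : metricType R) (phi : X -> Z) (s : Z -> X),
    cancel s phi /\ forall x y, mdist (phi x) (phi y) = rho x y.
Proof.
move=> rhoxx rho_sym rho_tri.
have rho_ge0 x y : 0 <= rho x y.
  by have := rho_tri y x x; rewrite rhoxx (rho_sym y); lra.
pose r (x y : {classic X}) := rho x y == 0.
have r_refl : reflexive r by move=> x; rewrite /r rhoxx.
have r_sym : symmetric r by move=> x y; rewrite /r rho_sym.
have rho_congr x x' y : rho x x' = 0 -> rho x y = rho x' y.
  move=> xx'; have := rho_tri x' x y; have := rho_tri x x' y.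
  rewrite (rho_sym x' x) xx' !add0r => xy yx.
  by apply/eqP; rewrite eq_le xy yx.
have r_trans : transitive r.
  by move=> y x z /eqP xy; rewrite /r (rho_congr _ _ _ xy).
pose E := EquivRel r r_refl r_sym r_trans.
pose Q := {eq_quot E}%qT.
pose dist (p q : Q) := rho (repr p) (repr q).
have dist_pos p q : dist p q = 0 -> p = q.
  move=> pq; rewrite -[p]reprK -[q]reprK; apply/eqmodP; exact/eqP.
have dist_pi x y : dist (\pi x)%qT (\pi y)%qT = rho x y.
  have reprP z : rho (repr (\pi_Q z)%qT) z = 0.
    by apply/eqP; suff : E (repr (\pi_Q z)%qT) z by []; apply/eqmodP; rewrite reprK.
  rewrite /dist (rho_congr _ _ _ (reprP x)) rho_sym.
  by rewrite (rho_congr _ _ _ (reprP y)) rho_sym.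
pose M := isMetric.Build R Q (fun p => rhoxx (repr p)) dist_pos
  (fun p q => rho_sym _ _) (fun q p s => rho_tri _ _ _).
pose Z : metricType R := HB.pack Q M.
exists Z, (fun x => (\pi_Q x)%qT), (fun q : Q => repr q); split=> //.
exact: reprK.
Qed.

(** The quotient identifies the points that meet within every [e].  The map
    passes to it, and its iterates are equicontinuous, because meeting is
    preserved by all iterates uniformly.  Points that meet within every [e] are
    proximal: syndetic return provides close times that are positive. *)
Lemma proximal_kernel_equicontinuous_factor (R : realType) (X : metricType R)
    (T : X -> X) :
  is_system T -> syndetic_return T ->
  exists (Z : metricType R) (Q : Z -> Z) (phi : X -> Z),
    [/\ equicontinuous_system Q, factor_map T Q phi &
      forall x y, phi x = phi y -> proximal_pair T x y].
Proof.
move=> [[x0 _] cX cT sT] ret.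
have [|||| rho [rhoxx rho_sym rho_tri rhoV Vrho]] :=
  @pseudometric_of_relations R X (meet_within T).
- by move=> e x e0; exists 0%N; rewrite mdistxx.
- by move=> e x y [k xy]; exists k; rewrite metric_sym.
- by move=> d e x y de [k xy]; exists k; exact: lt_le_trans xy de.
- exact: meet_within_split.
have [Z [phi [s [sK phiE]]]] := metric_quotient rhoxx rho_sym rho_tri.
have rho_iter e : 0 < e -> exists d, 0 < d /\
    forall x y, rho x y < d -> forall m, rho (iter m T x) (iter m T y) < e.
  move=> /Vrho[d1 [/(meet_within_iter ret)[d2 [/rhoV[d [d0 dP]] d2P]] d1P]].
  by exists d; split=> // x y xy m; exact/d1P/d2P/dP.
pose Q z := phi (T (s z)).
have phiT x : phi (T x) = Q (phi x).
  apply: mdist_positivity; apply/eqP; rewrite eq_le mdist_ge0 andbT.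
  apply/ler_addgt0Pl => e e0; rewrite addr0 phiE ltW //.
  have [d [d0 dP]] := rho_iter _ e0.
  by apply: (dP _ _ _ 1%N); rewrite -phiE sK mdistxx.
have phi_iter m x : phi (iter m T x) = iter m Q (phi x).
  by elim: m => //= m <-.
have cphi : continuous phi.
  move=> x; apply/cvgrPdist_lt => e /Vrho[d [d0 dP]].
  apply/nbhs_mdistP; exists d => // y /= xy; rewrite phiE; apply: dP.
  by exists 0%N.
have Qeq e : 0 < e -> exists d, 0 < d /\
    forall x y, mdist x y < d -> forall m, mdist (iter m Q x) (iter m Q y) < e.
  move=> /rho_iter[d [d0 dP]]; exists d; split=> // x y xy m.
  by rewrite -[x]sK -[y]sK -!phi_iter phiE; apply: dP; rewrite -phiE !sK.
have phi_surj : set_surj [set: X] [set: Z] phi by move=> z _; exists (s z).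
exists Z, Q, phi; split=> //.
- split; last by move=> e /Qeq[d [d0 dP]]; exists d; split=> // x y /dP.
  split.
  + by exists (phi x0).
  + have <- : phi @` [set: X] = [set: Z].
      by apply/seteqP; split=> // z _; exact: phi_surj.
    by apply: continuous_compact => //; exact: continuous_subspaceT.
  + move=> z; apply/cvgrPdist_lt => e /Qeq[d [d0 dP]].
    by apply/nbhs_mdistP; exists d => // w /= /dP /(_ 1%N).
  + move=> z _; have [x _ xs] := sT (s z) I.
    by exists (phi x) => //; rewrite -phiT xs sK.
- move=> x y xy e e0.
  have [d [L [/rhoV[d' [d'0 d'P]] dP]]] := meet_within_return ret e0.
  have /d'P/dP[n0 xyP] : rho x y < d' by rewrite -phiE xy mdistxx.
  have [k [_ kP]] := xyP n0.+1 (leqnSn _).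
  by exists (n0.+1 + k)%N.
Qed.

(** * The characterization *)

Theorem corollary3p5 (R : realType) (X : metricType R) (T : X -> X)
    (hT : minimal_system T)
    (Xeq : metricType R) (Teq : Xeq -> Xeq) (pi : X -> Xeq)
    (hpi : max_equicontinuous_factor T Teq pi) :
  broken_sensitive piecewise_syndetic T <-> ~ proximal_extension T Teq pi.
Proof.
have [sysT _] := hT; have [eqTeq fpi pimax] := hpi.
split=> [sens prox|nprox].
  exact: (proximal_extension_not_broken_sensitive sysT eqTeq prox).
apply: contrapT => nsens; apply: nprox; split=> // x y pixy.
have [Z [Q [phi [eqQ fphi phi_prox]]]] :=
  proximal_kernel_equicontinuous_factor sysT
    (not_broken_sensitive_syndetic_return hT nsens).
have [psi [_ psiE]] := pimax _ _ _ eqQ fphi.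
by apply: phi_prox; rewrite -!psiE pixy.
Qed.
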